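(* Let $X_1,\ldots,X_n$ be i.i.d. random vectors in $\mathbb{R}^2$ with mean vector and positive definite covariance matrix, and write $X_i=(X_{1i},X_{2i})^\top$, $a=(-1,1)^\top$, $Z_i=a^\top X_i=X_{2i}-X_{1i}$. Then (for every realization of the sample) for every $d\in\mathbb{R}$, $$\sup_{\mu\in\mathbb{R}^2:\ a^\top\mu=d}L_n(\mu)=L_{Z,n}(d).$$ Consequently, with $H=\{\mu\in\mathbb{R}^2:a^\top\mu=0\}$ and $\Theta=\{\mu\in\mathbb{R}^2:a^\top\mu\ge0\}$, $$\sup_{\mu\in H}L_n(\mu)=L_{Z,n}(0),\qquad \sup_{\mu\in\Theta}L_n(\mu)=\sup_{d\ge0}L_{Z,n}(d).$$
   Context: Let $\mathcal{P}_n=\{p=(p_1,\ldots,p_n):p_i\ge0,\ \sum_{i=1}^np_i=1\}$. For $\mu\in\mathbb{R}^2$ the normalized (bivariate) empirical likelihood is $$L_n(\mu)=\sup\Big\{\prod_{i=1}^n(np_i):\ p\in\mathcal{P}_n,\ \sum_{i=1}^np_i(X_i-\mu)=0\Big\},$$ and for $d\in\mathbb{R}$ the scalar empirical likelihood of the differences is $$L_{Z,n}(d)=\sup\Big\{\prod_{i=1}^n(np_i):\ p\in\mathcal{P}_n,\ \sum_{i=1}^np_i(Z_i-d)=0\Big\}.$$ In both cases the supremum over the empty set is $0$. *)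

(* Defs.v *)
From mathcomp Require Import all_boot all_order all_algebra.
From mathcomp Require Import all_classical all_reals all_analysis.

Set Implicit Arguments.
Unset Strict Implicit.
Unset Printing Implicit Defensive.

Import Order.TTheory GRing.Theory Num.Theory.
Import numFieldNormedType.Exports.

Local Open Scope classical_set_scope.
Local Open Scope ring_scope.

Section RandomVectors.
Context {disp : measure_display} {T : measurableType disp} {R : realType}.
Variable P : probability T R.

Definition borel_vec (m : nat) : set (set 'cV[R]_m) :=
  <<s [set U : set 'cV[R]_m | open U] >>.

Definition random_vector (m : nat) (X : T -> 'cV[R]_m) : Prop :=
  forall B, borel_vec B -> measurable (X @^-1` B).

Definition identically_distributed (n m : nat) (X : 'I_n -> T -> 'cV[R]_m) : Prop :=
  forall i j B, borel_vec B -> P (X i @^-1` B) = P (X j @^-1` B).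

Definition mutually_independent (n m : nat) (X : 'I_n -> T -> 'cV[R]_m) : Prop :=
  forall (J : {set 'I_n}) (B : 'I_n -> set 'cV[R]_m),
    (forall i, borel_vec (B i)) ->
    P (\bigcap_(i in [set` J]) (X i @^-1` B i)) =
      (\prod_(i in J) P (X i @^-1` B i))%E.

Definition iid_vectors (n m : nat) (X : 'I_n -> T -> 'cV[R]_m) : Prop :=
  [/\ forall i, random_vector (X i),
      identically_distributed X & mutually_independent X].

Definition component (m : nat) (X : T -> 'cV[R]_m) (k : 'I_m) : T -> R :=
  fun w => X w k 0.

(* On a probability space this says exactly that the mean vector and the
   covariance matrix exist with finite entries. *)
Definition square_integrable (m : nat) (X : T -> 'cV[R]_m) : Prop :=
  forall k, component X k \in Lfun P 2%:E.

Definition covariance_matrix (m : nat) (X : T -> 'cV[R]_m) : 'M[R]_m :=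
  \matrix_(k, l) fine (covariance P (component X k) (component X l)).

End RandomVectors.

Definition positive_definite (R : realType) (m : nat) (S : 'M[R]_m) : Prop :=
  S^T = S /\ forall u : 'cV[R]_m, u != 0 -> 0 < (u^T *m S *m u) 0 0.

Section EmpiricalLikelihood.
Context {R : realType}.

Definition prob_weights (n : nat) : set ('I_n -> R) :=
  [set p | (forall i, 0 <= p i) /\ \sum_(i < n) p i = 1].

(* The real-valued [sup] is 0 on the empty set, which is the convention wanted
   here; the sets below are bounded above (by n ^ n), so [sup] is their genuine
   supremum whenever they are nonempty. *)
Definition EL (n : nat) (x : 'I_n -> 'cV[R]_2) (mu : 'cV[R]_2) : R :=
  sup [set \prod_(i < n) (n%:R * p i) | p in
        [set p | prob_weights p /\ \sum_(i < n) p i *: (x i - mu) = 0]].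

Definition ELZ (n : nat) (z : 'I_n -> R) (d : R) : R :=
  sup [set \prod_(i < n) (n%:R * p i) | p in
        [set p | prob_weights p /\ \sum_(i < n) p i * (z i - d) = 0]].

Definition avec : 'cV[R]_2 := \col_(k < 2) (if k == 0 then -1 else 1).

Definition contrast (mu : 'cV[R]_2) : R := (avec^T *m mu) 0 0.

Definition differences (n : nat) (x : 'I_n -> 'cV[R]_2) : 'I_n -> R :=
  fun i => contrast (x i).

End EmpiricalLikelihood.

(* Main.v *)
(** Every weight vector [p] satisfies the mean constraint for exactly one [mu],
    namely [\sum_i p i *: x i], and the contrast of that [mu] is the weighted
    mean of the differences.  So the weights admissible for some [mu] whose
    contrast lies in [D] are the weights admissible for some [d] in [D], and an
    iterated supremum is a supremum over a union. *)

Require Import Defs.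
From mathcomp Require Import all_boot all_order all_algebra.
From mathcomp Require Import all_classical all_reals all_analysis.

Import Order.TTheory GRing.Theory Num.Theory.
Import numFieldNormedType.Exports.

Local Open Scope classical_set_scope.
Local Open Scope ring_scope.

(* Nonnegativity is what makes the junk value [sup set0 = 0] of the empty
   members harmless. *)
Lemma sup_bigcup_nonneg (R : realType) (I : Type) (D : set I)
    (F : I -> set R) (B : R) :
  (forall i y, D i -> F i y -> 0 <= y <= B) ->
  sup [set sup (F i) | i in D] = sup (\bigcup_(i in D) F i).
Proof.
move=> FB; have [U0|/set0P[y0 Uy0]] := eqVneq (\bigcup_(i in D) F i) set0.
  rewrite U0 sup0; have F0 i : D i -> F i = set0.
    by move=> Di; rewrite -subset0 -U0 => y Fy; exists i.
  (* If [D] is empty, so is the set of suprema; otherwise that set is [[set 0]]. Its [sup] is [0]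
     either way. *)
  have [->|/set0P[i Di]] := eqVneq D set0; first by rewrite image_set0 sup0.
  rewrite (_ : [set _ | _ in _] = [set 0]) ?sup1//.
  apply/seteqP; split=> [_ [j Dj <-]|_ ->] /=; first by rewrite F0// sup0.
  by exists i; rewrite // F0// sup0.
have U_ub : has_ubound (\bigcup_(i in D) F i).
  by exists B => y [i Di Fy]; have /andP[] := FB i y Di Fy.
have F_ub i : D i -> has_ubound (F i).
  by move=> Di; exists B => y Fy; have /andP[] := FB i y Di Fy.
have U_ge0 : 0 <= sup (\bigcup_(i in D) F i).
  apply: le_trans (ub_le_sup U_ub Uy0).
  by case: Uy0 => i Di Fy; have /andP[] := FB i y0 Di Fy.
have supF_le i : D i -> sup (F i) <= sup (\bigcup_(i in D) F i).
  move=> Di; have [->|/set0P Fi0] := eqVneq (F i) set0; first by rewrite sup0.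
  by apply: ge_sup => // y Fy; apply: ub_le_sup => //; exists i.
apply/le_anti/andP; split.
  case: Uy0 => i0 Di0 _; apply: ge_sup; first by exists (sup (F i0)), i0.
  by move=> _ [i Di <-]; exact: supF_le.
apply: ge_sup; first by exists y0.
move=> y [i Di Fy]; apply: (le_trans (ub_le_sup (F_ub i Di) Fy)).
apply: ub_le_sup; last by exists i.
by exists (sup (\bigcup_(i in D) F i)) => _ [j Dj <-]; exact: supF_le.
Qed.

(** Each weight is one term of a nonnegative sum equal to 1, so every factor lies between [0] and
    [n]. This supplies the uniform bound required by [sup_bigcup_nonneg]. *)
Lemma prod_prob_weights_bounds (R : realType) (n : nat) (p : 'I_n -> R) :
  prob_weights p -> 0 <= \prod_(i < n) (n%:R * p i) <= n%:R ^+ n.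
Proof.
move=> [p_ge0 p_sum1].
have p_le1 i : p i <= 1.
  by rewrite -p_sum1 (bigD1 i)//= lerDl sumr_ge0.
apply/andP; split; first by apply: prodr_ge0 => i _; rewrite mulr_ge0.
rewrite -[X in _ <= _ ^+ X]card_ord -prodr_const.
by apply: ler_prod => i _; rewrite mulr_ge0//= ler_piMr.
Qed.

Lemma contrast_weighted_sum (R : realType) (n : nat) (p : 'I_n -> R)
    (y : 'I_n -> 'cV[R]_2) :
  contrast (\sum_(i < n) p i *: y i) = \sum_(i < n) p i * contrast (y i).
Proof.
rewrite /contrast mulmx_sumr summxE; apply: eq_bigr => i _.
by rewrite -scalemxAr mxE.
Qed.

Lemma contrastB (R : realType) (u v : 'cV[R]_2) :
  contrast (u - v) = contrast u - contrast v.
Proof. by rewrite /contrast mulmxBr !mxE. Qed.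

(** Applying the linear map [contrast] to the vector constraint gives the scalar one; conversely,
    the weighted mean of the [x i] solves the vector constraint, and the scalar one fixes its
    contrast. *)
Lemma contrast_constraint (R : realType) (n : nat) (x : 'I_n -> 'cV[R]_2)
    (p : 'I_n -> R) (d : R) :
  \sum_(i < n) p i = 1 ->
  (exists2 mu, contrast mu = d & \sum_(i < n) p i *: (x i - mu) = 0) <->
  \sum_(i < n) p i * (differences x i - d) = 0.
Proof.
move=> p_sum1; split=> [[mu <- /(congr1 contrast)]|pz0].
  rewrite contrast_weighted_sum [RHS]/contrast mulmx0 mxE => pc0.
  by rewrite -[RHS]pc0; apply: eq_bigr => i _; rewrite contrastB.
(* The only candidate: since the weights sum to 1, the vector constraint determines [mu]. *)
exists (\sum_(i < n) p i *: x i).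
  rewrite contrast_weighted_sum; apply/subr0_eq; rewrite -[RHS]pz0.
  under [RHS]eq_bigr do rewrite mulrBr.
  by rewrite sumrB -mulr_suml p_sum1 mul1r.
under eq_bigr do rewrite scalerBr.
by rewrite sumrB -scaler_suml p_sum1 scale1r subrr.
Qed.

(** An arbitrary [D] treats the level sets ([D] a singleton) and the half-plane ([D] a half-line) at
    once. *)
Lemma sup_EL_contrast (R : realType) (n : nat) (x : 'I_n -> 'cV[R]_2)
    (D : set R) :
  sup [set EL x mu | mu in [set mu | D (contrast mu)]] =
  sup [set ELZ (differences x) d | d in D].
Proof.
rewrite /EL /ELZ !(@sup_bigcup_nonneg _ _ _ _ (n%:R ^+ n)); first last.
- by move=> mu _ _ [p [pP _] <-]; exact: prod_prob_weights_bounds.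
- by move=> d _ _ [p [pP _] <-]; exact: prod_prob_weights_bounds.
(* Both iterated suprema are now suprema of unions, which agree because the same [p] are admissible:
   [mu] is sent to [contrast mu], and [d] is lifted to a [mu] depending on [p]. *)
congr sup; apply/seteqP.
split=> [_ [mu Dmu [p [pP p0] <-]]|_ [d Dd [p [pP p0] <-]]].
  exists (contrast mu) => //; exists p => //; split=> //.
  by apply/contrast_constraint; [case: pP|exists mu].
have [mu mud pmu0] := (contrast_constraint _ _ x p d pP.2).2 p0.
by exists mu; [rewrite /= mud|exists p].
Qed.

Theorem lemma2p1 (disp : measure_display) (T : measurableType disp)
    (R : realType) (P : probability T R) (n : nat) (n_gt0 : (0 < n)%N)
    (X : 'I_n -> T -> 'cV[R]_2)
    (X_iid : iid_vectors P X)
    (X_L2 : forall i, square_integrable P (X i))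
    (X_cov : forall i, positive_definite (covariance_matrix P (X i)))
    (w : T) :
  let x := fun i => X i w in
  let z := differences x in
  [/\ forall d : R,
        sup [set EL x mu | mu in [set mu : 'cV[R]_2 | contrast mu = d]] = ELZ z d,
      sup [set EL x mu | mu in [set mu : 'cV[R]_2 | contrast mu = 0]] = ELZ z 0
    & sup [set EL x mu | mu in [set mu : 'cV[R]_2 | 0 <= contrast mu]] =
      sup [set ELZ z d | d in [set d : R | 0 <= d]]].
Proof.
move=> x z.
have level d : sup [set EL x mu | mu in [set mu | contrast mu = d]] = ELZ z d.
  (* Over the singleton [[set d]] the outer supremum on the right has a single value. *)
  by rewrite (sup_EL_contrast _ _ x [set d]) image_set1 sup1.
by split=> //; exact: (sup_EL_contrast _ _ x [set d | 0 <= d]).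
Qed.
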